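(* For every prime power $q$ and every integer $n \geq 1$, $\chi(\Gamma_{l-i}(M_n(F_q))) = \omega(\Gamma_{l-i}(M_n(F_q))) = n+1$.
   Context: $F_q$ is the finite field with $q$ elements and $M_n(F_q)$ is the ring of all $n\times n$ matrices over $F_q$. For $X \in M_n(F_q)$, $[X] = \{AX : A \in M_n(F_q)\}$ is the left ideal generated by $X$. The undirected left-ideal relation graph $\Gamma_{l-i}(M_n(F_q))$ is the simple graph with vertex set $M_n(F_q)$ in which two distinct vertices $X, Y$ are adjacent if and only if $[X] \subset [Y]$ or $[Y] \subset [X]$, where $\subset$ denotes proper containment. $\chi(\Gamma)$ is the chromatic number and $\omega(\Gamma)$ the clique number of a graph $\Gamma$. *)

(* Defs.v *)
From HB Require Import structures.
From mathcomp Require Import all_boot all_order all_algebra.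

Set Implicit Arguments.
Unset Strict Implicit.
Unset Printing Implicit Defensive.

Import GRing.Theory.

Record sgraph := SGraph {
  vertex : finType;
  adj : rel vertex;
  adj_sym : symmetric adj;
  adj_irrefl : irreflexive adj
}.

Definition proper_coloring (G : sgraph) (k : nat)
    (c : {ffun vertex G -> 'I_k}) : bool :=
  [forall x, forall y, adj x y ==> (c x != c y)].

Definition colorable (G : sgraph) (k : nat) : bool :=
  [exists c : {ffun vertex G -> 'I_k}, proper_coloring c].

Lemma colorable_card (G : sgraph) : colorable G #|vertex G|.
Proof.
apply/existsP; exists [ffun x => enum_rank x].
apply/forallP=> x; apply/forallP=> y; apply/implyP=> xy; rewrite !ffunE.
by apply: contraTneq xy => /enum_rank_inj ->; rewrite adj_irrefl.
Qed.

Lemma colorable_ex (G : sgraph) : exists k, colorable G k.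
Proof. by exists #|vertex G|; apply: colorable_card. Qed.

Definition chromatic_number (G : sgraph) : nat := ex_minn (colorable_ex G).

Definition clique (G : sgraph) (S : {set vertex G}) : bool :=
  [forall x in S, forall y in S, (x != y) ==> adj x y].

Definition clique_number (G : sgraph) : nat :=
  \max_(S : {set vertex G} | clique S) #|S|.

Section LeftIdealGraph.

Variables (F : finFieldType) (n : nat).

Definition left_ideal (X : 'M[F]_n) : {set 'M[F]_n} :=
  [set (A *m X)%R | A : 'M[F]_n].

Definition left_ideal_adj : rel 'M[F]_n :=
  fun X Y => (X != Y) &&
    ((left_ideal X \proper left_ideal Y) || (left_ideal Y \proper left_ideal X)).

Lemma left_ideal_adj_sym : symmetric left_ideal_adj.
Proof. by move=> X Y; rewrite /left_ideal_adj eq_sym orbC. Qed.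

Lemma left_ideal_adj_irrefl : irreflexive left_ideal_adj.
Proof. by move=> X; rewrite /left_ideal_adj eqxx. Qed.

Definition left_ideal_graph : sgraph :=
  SGraph left_ideal_adj_sym left_ideal_adj_irrefl.

End LeftIdealGraph.

(* Main.v *)
(** Left ideals of a matrix ring correspond to row spaces, so [X] lies strictly
    below [Y] exactly when the row space of X is a proper subspace of that of Y,
    which forces rank X < rank Y.  Hence the rank is a proper colouring with
    n + 1 colours, while the partial identities of ranks 0, ..., n form a
    clique of n + 1 vertices. *)
Require Import Defs.
From mathcomp Require Import all_boot all_order all_algebra.

Set Implicit Arguments.
Unset Strict Implicit.
Unset Printing Implicit Defensive.

(** A proper colouring is injective on a clique, since distinct members are adjacent. *)
Lemma clique_card_colorable (G : sgraph) (k : nat) (S : {set vertex G}) :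
  colorable G k -> clique S -> #|S| <= k.
Proof.
case/existsP=> c /forallP c_proper /forall_inP cliqueS.
have c_inj : {in S &, injective c}.
  move=> x y xS yS cxy; apply/eqP; apply: contraT => neq_xy.
  have /forall_inP/(_ y yS)/implyP/(_ neq_xy) xy := cliqueS x xS.
  by have /forallP/(_ y)/implyP/(_ xy) := c_proper x; rewrite cxy eqxx.
by rewrite -(card_in_imset c_inj) -[leqRHS]card_ord max_card.
Qed.

Lemma clique_number_le (G : sgraph) (k : nat) :
  colorable G k -> clique_number G <= k.
Proof. by move=> Gk; apply/bigmax_leqP=> S; apply: clique_card_colorable. Qed.

Lemma clique_le_number (G : sgraph) (S : {set vertex G}) :
  clique S -> #|S| <= clique_number G.
Proof. by move=> cliqueS; rewrite /clique_number (bigD1 S) /= ?leq_maxl. Qed.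

Lemma left_ideal_subset (F : finFieldType) (n : nat) (X Y : 'M[F]_n) :
  (left_ideal X \subset left_ideal Y) = (X <= Y)%MS.
Proof.
apply/subsetP/submxP=> [sXY | [D ->] _ /imsetP[A _ ->]].
  (* The inclusion need only be tested on the generator [X], which is [1%:M *m X]. *)
  have /sXY/imsetP[D _ ->] : X \in left_ideal X.
    by apply/imsetP; exists (1%:M)%R; rewrite ?mul1mx.
  by exists D.
by rewrite mulmxA; apply: imset_f.
Qed.

Lemma left_ideal_proper (F : finFieldType) (n : nat) (X Y : 'M[F]_n) :
  (left_ideal X \proper left_ideal Y) = (X < Y)%MS.
Proof. by rewrite properE !left_ideal_subset. Qed.

Lemma left_ideal_graph_colorable (F : finFieldType) (n : nat) :
  colorable (left_ideal_graph F n) n.+1.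
Proof.
pose c := [ffun X : 'M[F]_n => inord (\rank X) : 'I_n.+1].
apply/existsP; exists c; apply/forallP=> X; apply/forallP=> Y; apply/implyP.
rewrite /= /left_ideal_adj !left_ideal_proper => /andP[_ ltXY].
(* Ranks are at most [n], so [inord] never falls back to its default and distinct ranks keep
   distinct colours. *)
rewrite !ffunE -val_eqE /= !inordK ?ltnS ?rank_leq_row // neq_ltn.
by case/orP: ltXY; rewrite ltmxErank => /andP[_ ->]; rewrite ?orbT.
Qed.

Lemma pid_mx_ltmx (F : fieldType) (n r s : nat) :
  r < s -> s <= n -> ((pid_mx r : 'M[F]_n) < (pid_mx s : 'M[F]_n))%MS.
Proof.
move=> lt_rs le_sn; have le_rn := leq_trans (ltnW lt_rs) le_sn.
rewrite ltmxErank !rank_pid_mx // lt_rs andbT.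
(* As r < s, [pid_mx r] absorbs [pid_mx s]: their product is [pid_mx r] itself. *)
apply/submxP; exists (pid_mx r).
by rewrite mul_pid_mx (minn_idPl (ltnW lt_rs)) (minn_idPr le_rn).
Qed.

Lemma clique_pid_mx (F : finFieldType) (n : nat) :
  @clique (left_ideal_graph F n) [set (pid_mx (r : 'I_n.+1) : 'M[F]_n) | r : 'I_n.+1].
Proof.
apply/forall_inP=> _ /imsetP[r _ ->]; apply/forall_inP=> _ /imsetP[s _ ->].
apply/implyP=> neq_rs; rewrite /= /left_ideal_adj neq_rs !left_ideal_proper /=.
(* [neq_rs] separates the matrices, not the indices; equal indices would make it a matrix differing
   from itself. *)
case: (ltngtP r s) neq_rs => [lt_rs | lt_sr | ->]; last by rewrite eqxx.
  by rewrite pid_mx_ltmx ?leq_ord.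
by rewrite orbC pid_mx_ltmx ?leq_ord.
Qed.

(** The rank recovers [r] from [pid_mx r], so no two indices collide. *)
Lemma card_pid_mx (F : finFieldType) (n : nat) :
  #|[set (pid_mx (r : 'I_n.+1) : 'M[F]_n) | r : 'I_n.+1]| = n.+1.
Proof.
rewrite card_imset ?card_ord // => r s /(congr1 mxrank).
by rewrite !rank_pid_mx ?leq_ord // => /val_inj.
Qed.

Theorem theorem4p2 (F : finFieldType) (n : nat) (hn : 0 < n) :
  chromatic_number (left_ideal_graph F n) = clique_number (left_ideal_graph F n)
  /\ clique_number (left_ideal_graph F n) = n + 1.
Proof.
have colG := left_ideal_graph_colorable F n.
have omegaE : clique_number (left_ideal_graph F n) = n + 1.
  apply/eqP; rewrite addn1 eqn_leq clique_number_le //=.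
  by rewrite -[leqLHS](card_pid_mx F); apply: clique_le_number (clique_pid_mx F n).
split=> //; apply/eqP; rewrite /chromatic_number.
case: ex_minnP => k colGk k_min.
(* The clique bound gives n + 1 <= k; minimality of [k] against the rank colouring gives the
   converse. *)
by rewrite eqn_leq (clique_number_le colGk) omegaE addn1 k_min.
Qed.
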